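(* Let $n\geq 1$. Then in $\mathrm{NCSym}$ $$x_{\llbracket n\rrbracket}=(-1)^{n-1}\sum_{\sigma\vdash[n]}c_\sigma\, m_\sigma,$$ where $c_\sigma$ is the number of acyclic orientations of $K_\sigma$ with a unique sink at any fixed vertex (that is, for any choice of a vertex $v\in[n]$, $c_\sigma$ is the number of acyclic orientations of $K_\sigma$ whose unique sink is $v$).
   Context: A set partition $\pi\vdash[n]$ of $[n]=\{1,\dots,n\}$ is a collection of disjoint nonempty subsets (blocks) with union $[n]$; $\llbracket n\rrbracket$ is the set partition with the single block $[n]$. Set partitions of $[n]$ are ordered by refinement: $\sigma\le\pi$ if each block of $\sigma$ is contained in a block of $\pi$. $u$ is the Möbius function of this lattice: for $\sigma\le\pi$, $u(\sigma,\pi)=\prod_i(-1)^{k_i-1}(k_i-1)!$ where $k_i$ is the number of blocks of $\sigma$ contained in the $i$th block of $\pi$. In $\mathbb{Q}[[\mathbf{x}_1,\mathbf{x}_2,\dots]]$, noncommuting variables, for $\pi\vdash[n]$: $m_\pi=\sum\mathbf{x}_{i_1}\cdots\mathbf{x}_{i_n}$ over all tuples of positive integers $(i_1,\dots,i_n)$ with $i_j=i_k$ if and only if $j,k$ are in the same block of $\pi$; $p_\pi=\sum\mathbf{x}_{i_1}\cdots\mathbf{x}_{i_n}$ over all tuples with $i_j=i_k$ whenever $j,k$ are in the same block of $\pi$; and $x_\pi=\sum_{\sigma\le\pi}u(\sigma,\pi)\,p_\sigma$. $\mathrm{NCSym}$ is the algebra of symmetric functions in noncommuting variables, whose degree-$n$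 piece has each of $\{m_\pi\}_{\pi\vdash[n]}$, $\{p_\pi\}_{\pi\vdash[n]}$, $\{x_\pi\}_{\pi\vdash[n]}$ as a $\mathbb{Q}$-basis. For $\sigma\vdash[n]$, $K_\sigma$ is the complete multipartite graph on vertex set $[n]$ with an edge between $i$ and $j$ if and only if they lie in distinct blocks of $\sigma$. An acyclic orientation is an orientation of all edges with no directed cycle; a sink is a vertex with no outgoing edge (isolated vertices are sinks). *)

(* Defs.v *)
From mathcomp Require Import all_boot all_algebra.
From mathcomp Require Import boolp functions.

Set Implicit Arguments.
Unset Strict Implicit.
Unset Printing Implicit Defensive.

Import GRing.Theory.
Local Open Scope ring_scope.

(* A formal power series over Q in the noncommuting variables x_1, x_2, ... is
   the function giving its coefficient on each word; the letter i : nat stands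
   for the variable x_{i+1}. The Q-module operations are the pointwise ones of
   mathcomp.classical.functions; rat^o is rat as a module over itself. NCSym is a
   subspace of this module, so identities in NCSym are identities here. *)
Notation ncseries := (seq nat -> rat^o).

Section SetPartitions.

Variable n : nat.

(* [n] is represented by 'I_n, i.e. by {0, ..., n-1}. *)
Definition is_setpart (pi : {set {set 'I_n}}) : bool :=
  partition pi [set: 'I_n].

Definition one_block : {set {set 'I_n}} := [set [set: 'I_n]].

Definition same_block (pi : {set {set 'I_n}}) (j k : 'I_n) : bool :=
  [exists B in pi, (j \in B) && (k \in B)].

Definition refines (sigma pi : {set {set 'I_n}}) : bool :=
  [forall B in sigma, exists C in pi, B \subset C].

(* Möbius function of the partition lattice; meaningful when sigma refines pi. *)
Definition mobius (sigma pi : {set {set 'I_n}}) : rat :=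
  \prod_(C in pi)
    let k := #|[set B in sigma | B \subset C]| in
    (-1) ^+ k.-1 * ((k.-1)`!)%:R.

(* Distinct tuples give distinct words, so every coefficient is 0 or 1. *)
Definition m_series (pi : {set {set 'I_n}}) : ncseries := fun w =>
  ((size w == n) &&
   [forall j : 'I_n, forall k : 'I_n,
      (nth 0%N w j == nth 0%N w k) == same_block pi j k])%:R.

Definition p_series (pi : {set {set 'I_n}}) : ncseries := fun w =>
  ((size w == n) &&
   [forall j : 'I_n, forall k : 'I_n,
      same_block pi j k ==> (nth 0%N w j == nth 0%N w k)])%:R.

Definition x_series (pi : {set {set 'I_n}}) : ncseries :=
  \sum_(sigma : {set {set 'I_n}} | is_setpart sigma && refines sigma pi)
    mobius sigma pi *: p_series sigma.

Definition multipartite (sigma : {set {set 'I_n}}) : rel 'I_n :=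
  fun i j => ~~ same_block sigma i j.

End SetPartitions.

Arguments one_block n : clear implicits.

Section Orientations.

Variable T : finType.

Definition arc (A : {set T * T}) : rel T := fun x y => (x, y) \in A.

(* A set of arcs A orients the graph e if it contains exactly one of (x, y)
   and (y, x) for each edge xy, and no other pair. *)
Definition orientation (e : rel T) (A : {set T * T}) : bool :=
  [forall x, forall y,
     if e x y then arc A x y (+) arc A y x else ~~ arc A x y].

(* [cycle r c] holds when c = [:: x_0; ...; x_k] satisfies
   r x_0 x_1, ..., r x_{k-1} x_k and r x_k x_0. *)
Definition has_dicycle (A : {set T * T}) : Prop :=
  exists c : seq T, [/\ c != [::], uniq c & cycle (arc A) c].

Definition sinks (A : {set T * T}) : {set T} :=
  [set x | [forall y, ~~ arc A x y]].

Definition acyclic_orientations_with_sink (e : rel T) (v : T) :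
    {set {set T * T}} :=
  [set A | [&& orientation e A, ~~ `[< has_dicycle A >]
             & sinks A == [set v]]].

End Orientations.

(* Main.v *)
(* The coefficient of a word w in x_[n] only depends on the set partition tau
   of its positions with equal letters: it is the alternating sum of
   (-1)^(k-1) (k-1)! over the partitions of [n] into k stable sets of K_tau.
   By Greene and Zaslavsky this is, up to sign, the number of acyclic
   orientations with unique sink v, for any finite graph and any vertex v.

   For a vertex set V, let a(V) be the sum of (-1)^k k! over its partitions into
   k stable sets, and b(V) = (-1)^|V| #(acyclic orientations of V). Removing one
   block shows that the sum of a(V \ S) over the stable subsets S of V vanishes
   for nonempty V. The same holds for b: acyclic orientations of V \ S
   correspond to those of V in which S consists of sinks, and an acyclic
   orientation of a nonempty graph has a sink, so that the signs (-1)^|S|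
   cancel. Hence a = b. Running both arguments over the sets S containing v
   leaves only the orientations with unique sink v. *)
Require Import Defs.
From mathcomp Require Import all_boot all_algebra.
From mathcomp Require Import boolp functions.
Import GRing.Theory.
Local Open Scope ring_scope.
Set Implicit Arguments.
Unset Strict Implicit.
Unset Printing Implicit Defensive.

(* path.arc shadows the relation of the definitions. *)
Local Notation arc := Defs.arc.

Lemma partition_block_subset (T : finType) (P : {set {set T}}) (D B : {set T}) :
  partition P D -> B \in P -> B \subset D.
Proof. by move=> /cover_partition <- BP; apply: bigcup_sup. Qed.

Section AcyclicOrientations.

Variable (T : finType) (e : rel T).
Hypothesis e_sym : symmetric e.

(** * Signed sums over subsets *)

Lemma sum_sign_subset (X : {set T}) :
  \sum_(S : {set T} | S \subset X) (-1) ^+ #|S| = (X == set0)%:R :> rat.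
Proof.
(* Expanded, the product has one term per S, taking the first summand at each i in S: it is (-1)^|S|
   if S lies in X and 0 otherwise. Each i in X gives a factor 0. *)
transitivity (\prod_(i : T) ((if i \in X then -1 else 0) + 1) : rat).
  rewrite bigA_distr [RHS](bigID (fun S : {set T} => S \subset X)) /=.
  rewrite [X in _ + X]big1 ?addr0 => [|S /subsetPn[i iS iX]]; last first.
    by rewrite (bigD1 i) //= iS (negbTE iX) mul0r.
  apply: eq_bigr => S SX; rewrite -big_mkcond /= -prodr_const.
  by apply: eq_bigr => i /(subsetP SX) ->.
have [->|[i iX]] := set_0Vmem X.
  by rewrite eqxx big1 // => i _; rewrite inE add0r.
rewrite (bigD1 i) //= iX addNr mul0r; case: eqP => // X0.
by rewrite X0 inE in iX.
Qed.

(** Removing v maps these S bijectively onto the subsets of [X :\ v] and flips the sign, which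
    reduces to the unrestricted sum. *)
Lemma sum_sign_subset_mem (v : T) (X : {set T}) : v \in X ->
  \sum_(S : {set T} | (S \subset X) && (v \in S)) (-1) ^+ #|S|
    = - (X == [set v])%:R :> rat.
Proof.
move=> vX; have -> : (X == [set v]) = (X :\ v == set0).
  by rewrite setD_eq0 subset1; case: (X =P set0) vX => [->|]; rewrite ?inE ?orbF.
rewrite -sum_sign_subset -sumrN.
rewrite (reindex_onto (fun S => v |: S) (fun S => S :\ v)) /=; last first.
  by move=> S /andP[_ vS]; rewrite setD1K.
apply: eq_big => [S|S /andP[/andP[SX _] /eqP <-]].
  rewrite subUset sub1set vX setU11 andbT /= subsetD1.
  have [vS|vS] := boolP (v \in S); last by rewrite setU1K ?eqxx.
  by rewrite andbF; apply/negbTE/negP => /andP[_ /eqP /setP /(_ v)]; rewrite !inE eqxx vS.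
by rewrite setD1K ?setU11// (cardsD1 v (v |: S)) setU11 exprS mulN1r.
Qed.

(** * Partitions into stable sets *)

Definition stable (S : {set T}) : bool :=
  [forall x in S, forall y in S, ~~ e x y].

Lemma stableP (S : {set T}) :
  reflect {in S &, forall x y, ~~ e x y} (stable S).
Proof.
apply: (iffP 'forall_in_forall_inP) => H x y; first by move=> xS; apply: H.
by move=> xS; apply: H.
Qed.

Definition stable_partition (V : {set T}) (P : {set {set T}}) : bool :=
  partition P V && [forall B in P, stable B].

Lemma stable_partition_set0 P : stable_partition set0 P = (P == set0).
Proof.
by rewrite /stable_partition partition_set0; case: eqP => //= ->;
  apply/forall_inP => B; rewrite inE.
Qed.

(** Splitting off the block B turns a pair (P, B) into a stable set S = B with a stable partition of
    the rest, so [F] sees the number of remaining blocks. [Q] will be either trivial or the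
    condition that S contains v. *)
Lemma sum_stable_partition_block (V : {set T}) (Q : pred {set T}) (F : nat -> rat) :
  \sum_(P | stable_partition V P) \sum_(B in P | Q B) F #|P :\ B|
  = \sum_(S : {set T} | [&& S \subset V, stable S, S != set0 & Q S])
      \sum_(P | stable_partition (V :\: S) P) F #|P|.
Proof.
rewrite !pair_big_dep /=.
rewrite (reindex_onto (fun p => (p.1 |: p.2, p.1)) (fun p => (p.2, p.1 :\ p.2))) /=;
  last by move=> [P B] /= /and3P[_ BP _]; rewrite setD1K.
apply: eq_big => [[S P]|[S P] /andP[_ /eqP[->]] //] /=.
rewrite setU11 xpair_eqE eqxx /= /stable_partition.
apply/idP/idP => [/andP[/andP[/andP[PV stP] QS] /eqP PS]|].
  have SP : S \in S |: P by rewrite setU11.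
  have:= partitionD1 PV SP; rewrite PS => ->.
  rewrite (partition_block_subset PV SP) (partition_neq0 PV SP) QS.
  rewrite (forall_inP stP) //=; apply/forall_inP => B BP.
  by apply: (forall_inP stP); rewrite inE BP orbT.
move=> /andP[/and4P[SV stS S0 QS] /andP[PV stP]].
have dS : [disjoint S & V :\: S] by rewrite -setI_eq0 setIDA setIC setDIl setDv setI0.
have := partitionU1 PV S0 dS.
have -> : S :|: V :\: S = V by rewrite -[X in X :|: _](setIidPr SV) setID.
move=> ->; rewrite QS /=.
have SP : S \notin P.
  apply/negP => /(partition_block_subset PV); rewrite subsetD => /andP[_].
  by rewrite -setI_eq0 setIid (negbTE S0).
rewrite setU1K // eqxx !andbT; apply/forall_inP => B /setU1P[->//|].
exact: (forall_inP stP).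
Qed.


(** * Acyclic orientations of induced subgraphs *)

Definition induced (V : {set T}) : rel T := fun x y => [&& e x y, x \in V & y \in V].

(** All induced subgraphs keep the vertex type [T]. A vertex outside V is isolated and so belongs to
    [sinks A], which is why [V :&: sinks A] is used below. *)
Definition acyclic_orientations (V : {set T}) : {set {set T * T}} :=
  [set A | orientation (induced V) A && ~~ `[< has_dicycle A >]].

Lemma orientationP (r : rel T) (A : {set T * T}) :
  reflect (forall x y, if r x y then arc A x y (+) arc A y x : bool else ~~ arc A x y)
          (orientation r A).
Proof. exact: 'forall_forallP. Qed.

Lemma acyclic_orientationsP (V : {set T}) (A : {set T * T}) :
  reflect (orientation (induced V) A /\ ~ has_dicycle A)
          (A \in acyclic_orientations V).
Proof. by rewrite inE; apply: (iffP andP) => -[oA /asboolPn]. Qed.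

Lemma arc_oriented (r : rel T) (A : {set T * T}) (x y : T) :
  orientation r A -> arc A x y -> r x y.
Proof. by move=> /orientationP/(_ x y); case: r => // /negP. Qed.

Lemma has_dicycle_sub (A B : {set T * T}) :
  A \subset B -> has_dicycle A -> has_dicycle B.
Proof.
move=> /subsetP AB [c [c0 cu cA]]; exists c; split => //.
by apply: sub_cycle cA => x y; apply: AB.
Qed.

Lemma sinkP (A : {set T * T}) (x : T) :
  reflect (forall y, ~~ arc A x y) (x \in sinks A).
Proof. by rewrite inE; apply: forallP. Qed.

Definition cone_over (V S : {set T}) (A : {set T * T}) : {set T * T} :=
  A :|: [set p | [&& e p.1 p.2, p.1 \in V :\: S & p.2 \in S]].

Lemma arc_cone_over V S A x y :
  arc (cone_over V S A) x y = arc A x y || [&& e x y, x \in V :\: S & y \in S].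
Proof. by rewrite /arc 2!inE. Qed.

(** Restriction to [V :\: S] and [cone_over V S] are mutually inverse: as S is stable, each edge of
    V meeting S has its other end in [V :\: S], and the sinks in S force its direction. *)
Lemma card_acyclic_orientations_sinks (V S : {set T}) :
  S \subset V -> stable S ->
  #|[set A in acyclic_orientations V | S \subset sinks A]|
    = #|acyclic_orientations (V :\: S)|.
Proof.
move=> SV /stableP stS; rewrite -!sum1_card.
pose restr (A : {set T * T}) := A :&: setX (V :\: S) (V :\: S).
have arc_restr A x y :
    arc (restr A) x y = [&& arc A x y, x \in V :\: S & y \in V :\: S].
  by rewrite /arc /restr 2!inE.
rewrite (reindex_onto (cone_over V S) restr) /=; last first.
  move=> A; rewrite !inE => /andP[/andP[oA _]] /subsetP Ss.
  apply/setP => -[x y]; rewrite -![_ \in _]/(arc _ _ _) arc_cone_over arc_restr !inE.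
  have := orientationP _ _ oA x y; rewrite /induced.
  have [xS|xS] := boolP (x \in S).
    by rewrite /= !andbF (negbTE (sinkP _ _ (Ss _ xS) y)).
  have [yS|yS] := boolP (y \in S).
    rewrite (negbTE (sinkP _ _ (Ss _ yS) x)) addbF (subsetP SV _ yS) /=.
    by case: (e x y) => /=; case: (x \in V) => //=; case: arc.
  by rewrite /= !andbF orbF; case: (e x y) => /=; case: (x \in V); case: (y \in V) => //=;
     case: arc.
apply: eq_bigl => A; apply/andP/idP => [[]|].
  rewrite inE => /andP[/acyclic_orientationsP[oA cA] _] /eqP rA.
  apply/acyclic_orientationsP; split; last first.
    by apply: contra_not cA; apply: has_dicycle_sub; apply: subsetUl.
  apply/orientationP => x y; rewrite -{1 2 3}rA !arc_restr /induced.
  have := orientationP _ _ oA x y; rewrite /induced !inE.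
  by case: (x \in S) => /=; rewrite ?andbF //; case: (y \in S) => /=; rewrite ?andbF //;
     case: (x \in V) => /=; rewrite ?andbF //; case: (y \in V) => /=; rewrite ?andbF ?andbT.
move=> /acyclic_orientationsP[oA cA].
have arcV x y : arc A x y -> [&& e x y, x \in V :\: S & y \in V :\: S] 
  by move/(arc_oriented oA).
have arcN x y : ~~ [&& e x y, x \in V :\: S & y \in V :\: S] -> arc A x y = false.
  by move=> /(contraNN (@arcV x y))/negbTE.
have SsA x y : x \in S -> ~~ arc (cone_over V S A) x y.
  by move=> xS; rewrite arc_cone_over arcN !inE xS !andbF.
split.
  rewrite inE; apply/andP; split; last first.
    by apply/subsetP => x xS; apply/sinkP => y; apply: SsA.
  apply/acyclic_orientationsP; split; last first.
    move=> [c [c0 cu cc]]; apply: cA; exists c; split => //.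
    (* A vertex on a cycle has an outgoing arc, so the cycle avoids S and already lies in A. *)
    have cS x : x \in c -> x \notin S.
      move=> xc; apply/negP => /(SsA x (next c x)).
      by rewrite (next_cycle cc xc).
    apply: (sub_in_cycle (P := mem c)) cc; last by apply/allP.
    move=> x y xc yc /=; rewrite arc_cone_over.
    by case/orP => // /and3P[_ _ yS]; rewrite (negbTE (cS _ yc)) in yS.
  apply/orientationP => x y; rewrite !arc_cone_over /induced.
  have := orientationP _ _ oA x y; rewrite /induced (e_sym y x) !inE.
  have [xS|xS] := boolP (x \in S); have [yS|yS] := boolP (y \in S) => /=;
    rewrite ?(negbTE (stS _ _ xS yS)) ?andbF ?orbF //=.
  - rewrite (@arcN y x) ?inE ?xS ?andbF // (subsetP SV _ xS) => /negbTE->.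
    by case: (e x y); case: (y \in V).
  - rewrite (@arcN y x) ?inE ?yS ?andbF // (subsetP SV _ yS) => /negbTE->.
    by case: (e x y); case: (x \in V).
apply/eqP/setP => -[x y]; rewrite -![_ \in _]/(arc _ _ _) arc_restr arc_cone_over.
have [/arcV/and3P[_ -> ->]//|_] := boolP (arc A x y).
by rewrite !inE; case: (y \in S); rewrite ?andbF.
Qed.

Lemma acyclic_orientation_sink (V : {set T}) (A : {set T * T}) :
  A \in acyclic_orientations V -> V != set0 -> V :&: sinks A != set0.
Proof.
move=> /acyclic_orientationsP[oA cA] /set0Pn[x0 x0V].
(* A vertex reaching as few vertices as possible is a sink: otherwise it lies on a
   cycle with any out-neighbour. *)
have [x xV x_min] := arg_minnP (fun x => #|[set y | connect (arc A) x y]|) x0V.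
apply/set0Pn; exists x; rewrite inE [x \in V]xV /=; apply/sinkP => y.
apply/negP => xy; apply: cA.
have /and3P[_ _ yV] := arc_oriented oA xy.
(* Everything reachable from y is reachable from x; by minimality the two sets agree, and x reaches
   itself. *)
have yx : connect (arc A) y x.
  have sub : [set z | connect (arc A) y z] \subset [set z | connect (arc A) x z].
    apply/subsetP => z; rewrite !inE; apply: connect_trans.
    exact: connect1.
  have /eqP/setP/(_ x) : [set z | connect (arc A) y z] == [set z | connect (arc A) x z].
    by rewrite eqEcard sub x_min.
  by rewrite !inE connect0.
have [p p_path x_last] := connectP yx.
(* [has_dicycle] asks for distinct vertices, hence the shortened path. *)
case/shortenP: p_path x_last => p' p'_path p'_uniq _ p'_last.
exists (y :: p'); split => //=.
by rewrite rcons_path p'_path -p'_last.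
Qed.

(** Double counting of the pairs (S, A) in which S consists of sinks of A, with (-1)^|V \ S| =
    (-1)^|V| (-1)^|S|. *)
Lemma sum_stable_acyclic_orientations (V : {set T}) (Q : pred {set T}) :
  \sum_(S : {set T} | [&& S \subset V, stable S & Q S])
      (-1) ^+ #|V :\: S| * #|acyclic_orientations (V :\: S)|%:R
  = (-1) ^+ #|V| * \sum_(A in acyclic_orientations V)
      \sum_(S : {set T} | (S \subset V :&: sinks A) && Q S) (-1) ^+ #|S| :> rat.
Proof.
rewrite (exchange_big_dep (fun S : {set T} => [&& S \subset V, stable S & Q S]))
  /=; last first.
  (* A set of sinks in V is stable, since an edge inside it would leave one of its ends. *)
  move=> A S /acyclic_orientationsP[oA _]; rewrite subsetI => /andP[/andP[SV SA] ->].
  rewrite SV andbT /=; apply/stableP => x y xS yS.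
  have /sinkP/(_ y) := subsetP SA _ xS; have /sinkP/(_ x) := subsetP SA _ yS.
  have := orientationP _ _ oA x y; rewrite /induced !(subsetP SV) // !andbT.
  by case: e => //; do 2!case: arc.
rewrite mulr_sumr; apply: eq_bigr => S /and3P[SV stS QS].
rewrite -card_acyclic_orientations_sinks // -[X in _ * X%:R]sum1_card natr_sum !mulr_sumr.
apply: eq_big => [A|A _]; first by rewrite inE subsetI SV QS /= andbT.
rewrite mulr1 cardsD (setIidPr SV) -signr_odd oddB ?subset_leq_card //.
by rewrite signr_addb !signr_odd.
Qed.

(** * Stable partitions against acyclic orientations *)

Lemma alternating_stable_partitions (V : {set T}) :
  \sum_(P | stable_partition V P) (-1) ^+ #|P| * (#|P|`!)%:R
    = (-1) ^+ #|V| * #|acyclic_orientations V|%:R :> rat.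
Proof.
have [m] := ubnP #|V|; elim: m V => // m IHm V; rewrite ltnS => Vm.
have := sum_stable_acyclic_orientations V predT.
rewrite (eq_bigl (fun S : {set T} => (S \subset V) && stable S)); last first.
  by move=> S; rewrite andbT.
(* The term of the empty S is the right-hand side for V itself; all other terms concern smaller
   vertex sets. *)
rewrite (bigD1 set0) /=; last first.
  by rewrite sub0set; apply/stableP => x; rewrite inE.
rewrite setD0 => recV.
have sum_signs : \sum_(A in acyclic_orientations V)
    \sum_(S : {set T} | (S \subset V :&: sinks A) && predT S) (-1) ^+ #|S|
    = (V == set0)%:R * #|acyclic_orientations V|%:R :> rat.
  rewrite mulrC -sumr_const mulr_suml; apply: eq_bigr => A AV; rewrite mul1r.
  rewrite (eq_bigl (fun S : {set T} => S \subset V :&: sinks A)); last first.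
    by move=> S; rewrite andbT.
  rewrite sum_sign_subset; have [->|V0] := eqVneq V set0; first by rewrite set0I eqxx.
  by rewrite (negbTE (acyclic_orientation_sink AV V0)).
have [V0|V0] := eqVneq V set0.
  rewrite V0 (eq_bigl _ _ stable_partition_set0) big_pred1_eq !cards0 !mul1r.
  suff -> : acyclic_orientations set0 = [set set0] by rewrite cards1.
  apply/setP => A; rewrite in_set1; apply/acyclic_orientationsP/eqP => [[oA _]|->].
    apply/setP => -[x y]; rewrite inE; apply: negbTE; apply/negP => /(arc_oriented oA).
    by rewrite /induced inE andbF.
  split; last first.
    move=> [[|x c] [//= _ _]]; rewrite rcons_path /= => /andP[].
    by case: c => [|y c]; rewrite /= /arc !inE.
  by apply/orientationP => x y; rewrite /induced inE andbF /arc inE.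
move: recV; rewrite sum_signs (negbTE V0) mul0r mulr0 => /eqP.
rewrite addr_eq0 => /eqP ->.
(* Each of the k blocks of P leaves k-1 blocks, so P contributes k (-1)^(k-1) (k-1)! = -(-1)^k k!.
   Here k > 0 because V is nonempty. *)
have := sum_stable_partition_block V predT (fun k => (-1) ^+ k * k`!%:R).
rewrite (eq_bigr (fun P : {set {set T}} => - ((-1) ^+ #|P| * (#|P|`!)%:R))); last first.
  move=> P /andP[PV _].
  rewrite (eq_bigl (fun B => B \in P)); last by move=> B; rewrite andbT.
  rewrite (eq_bigr (fun _ => (-1) ^+ #|P|.-1 * (#|P|.-1`!)%:R)); last first.
    by move=> B BP; rewrite (cardsD1 B P) BP.
  have : #|P| != 0%N.
    apply: contra V0; rewrite cards_eq0 => /eqP P0.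
    by rewrite -(cover_partition PV) P0 /cover big_set0.
  rewrite sumr_const; case: #|P| => // k _ /=.
  by rewrite -[LHS]mulr_natr exprS mulN1r mulNr opprK factS mulnC natrM mulrA.
rewrite sumrN => /eqP; rewrite eqr_oppLR => /eqP ->; congr (- _).
apply: eq_big => [S|S /and4P[SV _ S0 _]].
  by rewrite andbT andbA.
apply: IHm; apply: leq_trans Vm; apply: proper_card.
by rewrite properE subsetDl subsetD subxx -setI_eq0 (setIidPr SV).
Qed.

(* The left-hand side is the linear coefficient of the chromatic polynomial. *)
Lemma alternating_stable_partitions_sink (V : {set T}) (v : T) : v \in V ->
  \sum_(P | stable_partition V P) (-1) ^+ #|P|.-1 * (#|P|.-1`!)%:R
    = (-1) ^+ #|V|.-1
      * #|[set A in acyclic_orientations V | V :&: sinks A == [set v]]|%:R :> rat.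
Proof.
move=> vV.
have := sum_stable_partition_block V (fun S : {set T} => v \in S)
  (fun k => (-1) ^+ k * k`!%:R).
(* Exactly one block of P contains v, so the inner sum has a single term. *)
rewrite (eq_bigr (fun P : {set {set T}} => (-1) ^+ #|P|.-1 * (#|P|.-1`!)%:R)); last first.
  move=> P /andP[PV _]; have tP := partition_trivIset PV.
  have vP : v \in cover P by rewrite (cover_partition PV).
  rewrite (big_pred1 (pblock P v)) => [|B].
    by rewrite (cardsD1 (pblock P v) P) pblock_mem.
  apply/andP/eqP => [[BP vB]|->]; last by rewrite pblock_mem // mem_pblock.
  by rewrite (def_pblock tP BP vB).
move=> ->.
under eq_bigr => S _ do rewrite alternating_stable_partitions.
rewrite (eq_bigl (fun S : {set T} => [&& S \subset V, stable S & v \in S])); last first.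
  move=> S; case: (S \subset V) => //=; case: (stable S) => //=.
  by have [vS|] := boolP (v \in S); rewrite ?andbF ?andbT //; apply/set0Pn; exists v.
rewrite sum_stable_acyclic_orientations.
(* The sign lost from (-1)^|V| is the one in [sum_sign_subset_mem]. *)
rewrite (cardsD1 v V) vV exprS mulN1r mulNr -mulrN; congr (_ * _).
rewrite -sum1_card natr_sum -sumrN.
rewrite [RHS](eq_bigl (fun A => (A \in acyclic_orientations V)
    && (V :&: sinks A == [set v]))) => [|A]; last by rewrite inE.
rewrite [RHS]big_mkcondr /=.
apply: eq_bigr => A _.
(* If v is not a sink, no S qualifies; if it is, the signs cancel unless v is the only sink in V. *)
have [vA|vA] := boolP (v \in V :&: sinks A).
  by rewrite sum_sign_subset_mem //; case: eqP; rewrite ?oppr0.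
rewrite big1 => [|S /andP[/subsetP/(_ v) SA /SA]]; last by rewrite (negbTE vA).
by case: eqP vA => // ->; rewrite inE eqxx.
Qed.

End AcyclicOrientations.

Lemma acyclic_orientations_with_sinkE (T : finType) (e : rel T) (v : T) :
  acyclic_orientations_with_sink e v
    = [set A in acyclic_orientations e [set: T] | [set: T] :&: sinks A == [set v]].
Proof.
apply/setP => A; rewrite !inE setTI andbA; congr (_ && _ && _).
by apply: eq_forallb => x; apply: eq_forallb => y; rewrite /induced !inE !andbT.
Qed.

Lemma scale_seriesE (a : rat) (f : ncseries) (w : seq nat) : (a *: f) w = a * f w.
Proof. by []. Qed.

(** * Coefficients of the series on a word *)

Section WordCoefficients.

Variable n : nat.
Implicit Types (sigma : {set {set 'I_n}}) (w : seq nat).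

Lemma same_block_pblock sigma j k : is_setpart sigma ->
  same_block sigma j k = (k \in pblock sigma j).
Proof.
move=> part; have jP : j \in cover sigma by rewrite (cover_partition part) inE.
apply/exists_inP/idP => [[B BP /andP[jB kB]]|kj].
  by rewrite (def_pblock (partition_trivIset part) BP jB).
by exists (pblock sigma j); rewrite ?pblock_mem // mem_pblock jP.
Qed.

Lemma multipartite_sym sigma : symmetric (multipartite sigma).
Proof.
move=> j k; rewrite /multipartite; congr negb; apply: eq_existsb => B.
by rewrite [(j \in B) && _]andbC.
Qed.

(** The partition tau of the positions. The default 0 of [nth] is itself a letter, so this describes
    w faithfully only when w has at least n letters. *)
Definition word_kernel w : {set {set 'I_n}} :=
  preim_partition (fun j : 'I_n => nth 0%N w j) [set: 'I_n].

Lemma word_kernel_setpart w : is_setpart (word_kernel w).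
Proof. exact: preim_partitionP. Qed.

Lemma same_block_word_kernel w j k :
  same_block (word_kernel w) j k = (nth 0%N w j == nth 0%N w k).
Proof.
rewrite same_block_pblock ?word_kernel_setpart // pblock_equivalence_partition //.
by move=> x y z _ _ _ /=; split => // /eqP ->.
Qed.

(** A set partition is determined by its relation [same_block], so each word of length n occurs in
    exactly one m_sigma. *)
Lemma m_series_word_kernel sigma w : is_setpart sigma -> size w = n ->
  m_series sigma w = (sigma == word_kernel w)%:R.
Proof.
move=> part wn; rewrite /m_series wn eqxx /=; congr (nat_of_bool _)%:R.
apply/'forall_forallP/eqP => /= [H|-> j k]; last by rewrite same_block_word_kernel.
rewrite -(equivalence_partition_pblock part); apply: eq_imset => j.
by apply/setP => k; rewrite !inE -same_block_pblock // -(eqP (H j k)).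
Qed.

(** Two positions are non-adjacent in K_tau exactly when their letters agree, so w is constant on a
    block exactly when the block is stable. *)
Lemma p_series_stable sigma w : size w = n ->
  p_series sigma w
    = [forall B in sigma, stable (multipartite (word_kernel w)) B]%:R.
Proof.
move=> wn; rewrite /p_series wn eqxx /=; congr (nat_of_bool _)%:R.
apply/'forall_forallP/forall_inP => /= [H B BP|H j k].
  apply/stableP => j k jB kB; rewrite negbK same_block_word_kernel.
  by apply: (implyP (H j k)); apply/exists_inP; exists B; rewrite ?jB.
apply/implyP => /exists_inP[B BP /andP[jB kB]].
by have /stableP/(_ j k jB kB) := H B BP; rewrite negbK same_block_word_kernel.
Qed.

Lemma refines_one_block sigma : refines sigma (one_block n).
Proof.
by apply/forall_inP => B _; apply/exists_inP; exists setT; rewrite ?inE ?subsetT.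
Qed.

Lemma mobius_one_block sigma :
  mobius sigma (one_block n) = (-1) ^+ #|sigma|.-1 * (#|sigma|.-1`!)%:R.
Proof.
rewrite /mobius big_set1 /=; suff -> : [set B in sigma | B \subset setT] = sigma by [].
by apply/setP => B; rewrite inE subsetT andbT.
Qed.

Lemma x_series_one_block w : size w = n ->
  x_series (one_block n) w
    = \sum_(P | stable_partition (multipartite (word_kernel w)) [set: 'I_n] P)
        (-1) ^+ #|P|.-1 * (#|P|.-1`!)%:R.
Proof.
move=> wn; rewrite /x_series fct_sumE big_mkcondr /= [RHS]big_mkcondr /=.
apply: eq_bigr => sigma _; rewrite refines_one_block /= mobius_one_block.
by rewrite scale_seriesE p_series_stable // [LHS]mulr_natr mulrb.
Qed.

End WordCoefficients.

Theorem theorem4p1 (n : nat) (n_gt0 : (0 < n)%N) :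
  exists c : {set {set 'I_n}} -> nat,
    (forall sigma : {set {set 'I_n}}, is_setpart sigma ->
       forall v : 'I_n,
         c sigma = #|acyclic_orientations_with_sink (multipartite sigma) v|) /\
    x_series (one_block n) =
      (-1) ^+ n.-1 *:
        \sum_(sigma : {set {set 'I_n}} | is_setpart sigma)
          (c sigma)%:R *: m_series sigma.
Proof.
pose v0 := Ordinal n_gt0.
exists (fun sigma => #|acyclic_orientations_with_sink (multipartite sigma) v0|).
have coef sigma (v : 'I_n) := alternating_stable_partitions_sink
  (multipartite_sym sigma) (in_setT v).
split=> [sigma _ v|].
  (* The sum over stable partitions does not mention the vertex, so after cancelling the sign the
     counts for [v0] and v agree. *)
  have := etrans (esym (coef sigma v0)) (coef sigma v).
  rewrite -!acyclic_orientations_with_sinkE.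
  by move/(mulfI (negbT (signr_eq0 _ _)))/eqP; rewrite Num.Theory.eqr_nat => /eqP.
apply/funext => w.
rewrite scale_seriesE fct_sumE.
have [wn|wn] := eqVneq (size w) n.
  rewrite x_series_one_block // (coef _ v0) cardsT card_ord; congr (_ * _).
  (* Only the kernel of w contributes to the coefficient of w. *)
  rewrite (bigD1 (word_kernel n w)) ?word_kernel_setpart //= big1 ?addr0.
    rewrite scale_seriesE m_series_word_kernel ?word_kernel_setpart // eqxx mulr1.
    by rewrite acyclic_orientations_with_sinkE.
  move=> sigma /andP[part neq].
  by rewrite scale_seriesE m_series_word_kernel // (negbTE neq) mulr0.
(* On words of any other length both sides vanish. *)
rewrite /x_series fct_sumE !big1 ?mulr0 // => sigma _.
  by rewrite scale_seriesE /m_series (negbTE wn) mulr0.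
by rewrite scale_seriesE /p_series (negbTE wn) mulr0.
Qed.
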